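(* Let $(X,\|\cdot\|)$ be a real normed space with $\dim X\ge 2$. Then $\|\cdot\|$ derives from an inner product if and only if $\Omega'(X)=1$.
   Context: For $x,y\in X$, $x$ is isosceles orthogonal to $y$, written $x\perp_I y$, if $\|x+y\|=\|x-y\|$. The constant $\Omega'(X)$ is defined by $$\Omega'(X)=\sup\left\{\frac{\|x+2y\|^2+\|2x+y\|^2}{5\|x+y\|^2}: x,y\in X,\ (x,y)\ne(0,0),\ x\perp_I y\right\}.$$ (If $x\perp_I y$ and $(x,y)\neq(0,0)$ then $x+y\ne0$, so the quotient is defined.) The norm derives from an inner product if there is an inner product $\langle\cdot,\cdot\rangle$ on $X$ with $\|x\|^2=\langle x,x\rangle$ for all $x\in X$. *)

(* Defs.v *)
From HB Require Import structures.
From mathcomp Require Import all_boot all_order all_algebra sesquilinear.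
From mathcomp Require Import all_classical all_reals all_analysis.
From mathcomp Require Import ring lra.

Set Implicit Arguments.
Unset Strict Implicit.
Unset Printing Implicit Defensive.

Import Order.TTheory GRing.Theory Num.Theory.
Import numFieldNormedType.Exports.

Local Open Scope classical_set_scope.
Local Open Scope ring_scope.

Definition lin_indep (K : fieldType) (V : lmodType K) (n : nat)
    (v : 'I_n -> V) : Prop :=
  forall c : 'I_n -> K, \sum_(i < n) c i *: v i = 0 -> forall i, c i = 0.

(* [n <= dim V]; V may be infinite-dimensional, so [\dim] and [free],
   which need a [vectType], do not apply. *)
Definition dim_ge (K : fieldType) (V : lmodType K) (n : nat) : Prop :=
  exists v : 'I_n -> V, lin_indep v.

Definition isosceles_orth (R : realType) (X : normedModType R) (x y : X) : Prop :=
  `|x + y| = `|x - y|.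

Definition Omega'_set (R : realType) (X : normedModType R) : set R :=
  [set r | exists x y : X, [/\ (x, y) <> (0, 0), isosceles_orth x y &
     r = (`|x + 2 *: y| ^+ 2 + `|2 *: x + y| ^+ 2) / (5 * `|x + y| ^+ 2)]].

(* The supremum is taken in R, where [sup] is meaningful only under [has_sup];
   this is [has_sup_Omega'_set] below. *)
Definition Omega' (R : realType) (X : normedModType R) : R :=
  sup (Omega'_set X).

(* [{dot X for idfun}] is the type of symmetric (idfun-hermitian) bilinear
   positive definite forms on X. *)
Definition norm_from_inner_product (R : realType) (X : normedModType R) : Prop :=
  exists ip : {dot X for (@idfun R)}, forall x : X, `|x| ^+ 2 = ip x x.

Lemma isosceles_orth_add_neq0 (R : realType) (X : normedModType R) (x y : X) :
  (x, y) <> (0, 0) -> isosceles_orth x y -> x + y != 0.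
Proof.
move=> nz xy; apply/eqP => s0; apply: nz.
have d0 : x - y = 0 by apply/normr0_eq0; rewrite -xy s0 normr0.
have yx : y = x by rewrite -(subr0 x) -d0 subKr.
have : 2 *: x = 0 by rewrite scaler_nat mulr2n -{2}yx.
by move/eqP; rewrite scaler_eq0 pnatr_eq0 /= yx => /eqP ->.
Qed.

Lemma has_sup_Omega'_set (R : realType) (X : normedModType R) :
  dim_ge X 1 -> has_sup (Omega'_set X).
Proof.
case=> v vfree; split.
  have v0 : v ord0 <> 0.
    move=> v0; have /(_ _ ord0)/eqP := vfree (fun=> 1).
    by rewrite big_ord1 v0 scaler0 oner_eq0 => /(_ erefl).
  eexists; exists (v ord0), 0; split; last by [].
  - by case.
  - by rewrite /isosceles_orth addr0 subr0.
exists (8 / 5) => _ [x [y [nz xy ->]]].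
have n0 : 0 < `|x + y| by rewrite normr_gt0 isosceles_orth_add_neq0.
have half : (2^-1 : R) * 2 = 1 by rewrite mulVf ?pnatr_eq0.
have bound (z w : X) : `|z + w| = `|x + y| -> `|z - w| = `|x + y| ->
    `|z + 2 *: w| <= 2 * `|x + y|.
  move=> zs zd.
  have -> : z + 2 *: w = (3 / 2) *: (z + w) - (1 / 2) *: (z - w).
    rewrite !scalerDr opprD scalerN opprK addrACA -scalerBl -scalerDl.
    have -> : 3 / 2 - 1 / 2 = 1 :> R by lra.
    have -> : 3 / 2 + 1 / 2 = 2 :> R by lra.
    by rewrite scale1r.
  rewrite (le_trans (ler_normB _ _))// !normrZ zs zd.
  rewrite !ger0_norm ?divr_ge0 ?ler0n ?ler01//; lra.
have b1 : `|x + 2 *: y| <= 2 * `|x + y| by apply: bound.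
have b2 : `|2 *: x + y| <= 2 * `|x + y|.
  by rewrite addrC; apply: bound; [rewrite addrC | rewrite distrC].
rewrite ler_pdivrMr ?mulr_gt0 ?exprn_gt0// ?ltr0n//.
have p1 := normr_ge0 (x + 2 *: y); have p2 := normr_ge0 (2 *: x + y).
nra.
Qed.

(* Main.v *)
Require Import Defs.
(* With u = x + y and v = x - y, the bound Omega'(X) <= 1 says that
   |3u + v|^2 + |3u - v|^2 <= 20 |u|^2 whenever |u| = |v|.  Restrict the norm
   to a plane, and let q be the quadratic form of largest determinant below the
   squared norm (Loewner's ellipse).  By maximality q touches the squared norm at
   two linearly independent points.  If z, w are contact points with q z = q w,
   the identity q (3z + w) + q (3z - w) = 20 q z forces 3z + w to be a contact
   point too, so the closed set of contact directions has no gap: the squared norm is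
   quadratic on every plane, and polarization gives the inner product. *)
From HB Require Import structures.
From mathcomp Require Import all_boot all_order all_algebra.
From mathcomp Require Import all_classical all_reals all_analysis.
From mathcomp Require Import sesquilinear ring lra.

Set Implicit Arguments.
Unset Strict Implicit.
Unset Printing Implicit Defensive.

Import Order.TTheory GRing.Theory Num.Theory.
Import numFieldNormedType.Exports.

Local Open Scope classical_set_scope.
Local Open Scope ring_scope.

(** * Continuity, closed sets and compactness on the line and the plane *)

Section RealContinuous.
Variables (R : realType) (T : topologicalType) (f g : T -> R).
Hypotheses (cf : continuous f) (cg : continuous g).

Lemma continuous_addr : continuous (fun x => f x + g x).
Proof. by move=> x; apply: (@continuousD R R^o); [exact: cf|exact: cg]. Qed.

Lemma continuous_subr : continuous (fun x => f x - g x).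
Proof. by move=> x; apply: (@continuousB R R^o); [exact: cf|exact: cg]. Qed.

Lemma continuous_mulr : continuous (fun x => f x * g x).
Proof. by move=> x; apply: continuousM; [exact: cf|exact: cg]. Qed.

Lemma continuous_sqr : continuous (fun x => f x ^+ 2).
Proof.
move=> x; apply: (@continuous_comp _ _ _ f (fun x : R => x ^+ 2)).
  exact: cf.
exact: exprn_continuous.
Qed.

Lemma closed_le_fun : closed [set x | f x <= g x].
Proof.
have -> : [set x | f x <= g x] = (fun x => g x - f x) @^-1` [set y | 0 <= y].
  by apply/seteqP; split=> x /=; rewrite subr_ge0.
apply: (preimage_closed _ (@closed_ge R 0)) => x _.
by apply: (@continuousB R R^o); [exact: cg | exact: cf].
Qed.

End RealContinuous.

Lemma closed_eq_fun (R : realType) (T : topologicalType) (f g : T -> R) :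
  continuous f -> continuous g -> closed [set x | f x = g x].
Proof.
move=> cf cg.
have -> : [set x | f x = g x] = [set x | f x <= g x] `&` [set x | g x <= f x].
  apply/seteqP; split=> x /= => [->|[fg gf]]; first by split.
  by apply/eqP; rewrite eq_le fg gf.
by apply: closedI; apply: closed_le_fun.
Qed.

(** If [t] were outside [P], the largest point of [P] in [[a, t]] and the smallest in [[t, b]] would
    bound a gap, and the last hypothesis puts a point of [P] inside it. *)
Lemma closed_between (R : realType) (P : set R) (a b t : R) :
    closed P -> P a -> P b -> a <= t <= b ->
    (forall r s, r < s -> P r -> P s -> exists2 m, r < m < s & P m) ->
  P t.
Proof.
move=> cP Pa Pb /andP[at_ tb] PP.
have cK c d : compact (P `&` `[c, d]).
  apply: subclosed_compact (@segment_compact _ c d) _; last by move=> ? [].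
  by apply: closedI => //; exact: interval_closed.
have cid (A : set R) : {within A, continuous (@id R)}.
  by apply: continuous_subspaceT => x; exact: cvg_id.
have [|r] := @compact_EVT_max R R id (P `&` `[a, t]) _ (cK _ _) (cid _).
  by exists a; split=> //=; rewrite in_itv/= lexx.
rewrite inE /= in_itv/= => -[Pr /andP[ar rt]] rmax.
have [|s] := @compact_EVT_min R R id (P `&` `[t, b]) _ (cK _ _) (cid _).
  by exists b; split=> //=; rewrite in_itv/= lexx andbT.
rewrite inE /= in_itv/= => -[Ps /andP[ts sb]] smin.
have [<-//|nrt] := eqVneq r t.
have {nrt}rt' : r < t by rewrite lt_neqAle nrt.
have [m /andP[rm ms] Pm] := PP r s (lt_le_trans rt' ts) Pr Ps.
have [mt|tm] := leP m t.
- have := rmax m; rewrite inE /= in_itv/= => H.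
  have : m <= r by apply: H; split=> //; rewrite mt (le_trans ar (ltW rm)).
  by rewrite leNgt rm.
- have := smin m; rewrite inE /= in_itv/= => H.
  have : s <= m by apply: H; split=> //; rewrite (ltW tm) (le_trans (ltW ms) sb).
  by rewrite leNgt ms.
Qed.

(** [m] is the minimum of [F] on the unit circle, attained by compactness; homogeneity spreads the
    bound to the plane. *)
Lemma pos_hom2_lower (R : realType) (F : R -> R -> R) :
    continuous (fun z : R * R => F z.1 z.2) ->
    (forall t a b, F (t * a) (t * b) = t ^+ 2 * F a b) ->
    (forall a b, 0 < a ^+ 2 + b ^+ 2 -> 0 < F a b) ->
  exists2 m, 0 < m & forall a b, m * (a ^+ 2 + b ^+ 2) <= F a b.
Proof.
move=> cF hF pF.
have c1 : continuous (@fst R R) by move=> ?; exact: cvg_fst.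
have c2 : continuous (@snd R R) by move=> ?; exact: cvg_snd.
pose S := [set z : R * R | z.1 ^+ 2 + z.2 ^+ 2 = 1].
have cS : compact S.
  have cI := @segment_compact R (-1) 1.
  apply: (subclosed_compact _ (compact_setX cI cI)) => [|[a b]]; rewrite /S /=.
    apply: closed_eq_fun => [|z]; last exact: cvg_cst.
    by apply: continuous_addr; exact: continuous_sqr.
  by rewrite !in_itv/= => ab1; split; apply/andP; split; nra.
have [||[a b]] := @compact_EVT_min _ R (fun z => F z.1 z.2) S _ cS.
- by exists (1, 0); rewrite /S /= expr1n expr0n addr0.
- exact: continuous_subspaceT.
rewrite inE /S /= => ab1 Fmin.
exists (F a b); first by apply: pF; rewrite ab1.
(* The origin cannot be normalized; there homogeneity with factor 0 gives [F 0 0 = 0]. *)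
move=> x y; have [xy0|xy0] := eqVneq (x ^+ 2 + y ^+ 2) 0.
  have := hF 0 x y; have -> : x = 0 by nra.
  have -> : y = 0 by nra.
  by rewrite !mul0r expr0n /= !mul0r => ->; rewrite addr0 mulr0.
have n0 : 0 < x ^+ 2 + y ^+ 2 by rewrite lt_neqAle eq_sym xy0 addr_ge0 ?sqr_ge0.
set r := Num.sqrt (x ^+ 2 + y ^+ 2).
have r0 : 0 < r by rewrite sqrtr_gt0.
have r2 : r ^+ 2 = x ^+ 2 + y ^+ 2 by rewrite sqr_sqrtr ?ltW.
have := Fmin (r^-1 * x, r^-1 * y); rewrite inE /S /= hF => /(_ _).
rewrite !exprMn -mulrDr -r2 exprVn mulVf ?expf_neq0 ?gt_eqF// => /(_ erefl).
by rewrite mulrC -ler_pdivlMr ?exprn_gt0// mulrC.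
Qed.

(** * Binary quadratic forms and the form of largest determinant below [F] *)

Definition qform (R : realType) (A B C a b : R) : R :=
  A * a ^+ 2 + 2 * B * (a * b) + C * b ^+ 2.

(** Complete the square after multiplying by [A]. *)
Lemma qform_gt0 (R : realType) (A B C a b : R) :
  0 < A -> 0 < A * C - B ^+ 2 -> 0 < a ^+ 2 + b ^+ 2 -> 0 < qform A B C a b.
Proof.
move=> A0 D0 ab0; rewrite -(pmulr_rgt0 _ A0) /qform.
have -> : A * (A * a ^+ 2 + 2 * B * (a * b) + C * b ^+ 2) =
  (A * a + B * b) ^+ 2 + (A * C - B ^+ 2) * b ^+ 2 by ring.
have [b0|b0] := eqVneq b 0.
  move: ab0; rewrite b0 expr0n !mulr0 !addr0 exprMn => ab0.
  by rewrite mulr_gt0 // exprn_gt0.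
rewrite ltr_wpDl ?sqr_ge0// mulr_gt0//.
by rewrite lt_neqAle eq_sym expf_neq0 ?sqr_ge0.
Qed.

Lemma qform_continuous (R : realType) (T : topologicalType)
    (A B C a b : T -> R) :
  continuous A -> continuous B -> continuous C -> continuous a ->
  continuous b ->
  continuous (fun z => qform (A z) (B z) (C z) (a z) (b z)).
Proof.
move=> cA cB cC ca cb.
have c2 : continuous (fun _ : T => 2 : R) by move=> z; exact: cvg_cst.
apply: continuous_addr; last by apply: continuous_mulr => //; exact: continuous_sqr.
apply: continuous_addr; first by apply: continuous_mulr => //; exact: continuous_sqr.
by apply: continuous_mulr; exact: continuous_mulr.
Qed.

(** The positive semidefinite forms below [F] make up a compact set [K] of triples, on which the
    determinant attains its maximum. The weak inequalities keep [K] closed; strictness comes back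
    because [K] contains a multiple of the Euclidean form. *)
Lemma max_det_qform (R : realType) (F : R -> R -> R) :
    continuous (fun z : R * R => F z.1 z.2) ->
    (forall t a b, F (t * a) (t * b) = t ^+ 2 * F a b) ->
    (forall a b, 0 < a ^+ 2 + b ^+ 2 -> 0 < F a b) ->
  exists A B C, [/\ 0 < A, 0 < A * C - B ^+ 2,
    forall a b, qform A B C a b <= F a b &
    forall A' B' C', 0 <= A' -> 0 <= C' -> 0 <= A' * C' - B' ^+ 2 ->
      (forall a b, qform A' B' C' a b <= F a b) ->
      A' * C' - B' ^+ 2 <= A * C - B ^+ 2].
Proof.
move=> cF hF pF.
have [m m0 Fm] := pos_hom2_lower cF hF pF.
have cst (c : R) : continuous (fun _ : R * R * R => c) by move=> ?; exact: cvg_cst.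
have c1 : continuous (fun z : R * R * R => z.1.1).
  by move=> z; apply: (@continuous_comp _ _ _ fst fst); exact: cvg_fst.
have c2 : continuous (fun z : R * R * R => z.1.2).
  by move=> z; apply: (@continuous_comp _ _ _ fst snd); [exact: cvg_fst|exact: cvg_snd].
have c3 : continuous (fun z : R * R * R => z.2) by move=> z; exact: cvg_snd.
pose det (z : R * R * R) : R := z.1.1 * z.2 - z.1.2 ^+ 2.
have cdet : continuous det.
  by apply: continuous_subr; [exact: continuous_mulr|exact: continuous_sqr].
pose K := [set z : R * R * R | 0 <= z.1.1] `&` [set z | 0 <= z.2] `&`
  [set z | 0 <= det z] `&`
  \bigcap_(u : R * R) [set z | qform z.1.1 z.1.2 z.2 u.1 u.2 <= F u.1 u.2].
have KP z : K z <-> [/\ 0 <= z.1.1, 0 <= z.2, 0 <= det z &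
    forall a b, qform z.1.1 z.1.2 z.2 a b <= F a b].
  split=> [[[[z1 z2] z3] z4]|[z1 z2 z3 z4]].
    by split=> // a b; exact: (z4 (a, b)).
  by split=> [|u _ /=]; [do !split|exact: z4].
(* One bound for all three coefficients: [A <= F 1 0], [C <= F 0 1], and [B ^+ 2 <= A * C] bounds
   [B] since [|B| <= 1 + B ^+ 2]. *)
pose M := 1 + F 1 0 + F 0 1 + F 1 0 * F 0 1.
have cK : compact K.
  have cI := @segment_compact R (- M) M.
  apply: (subclosed_compact _ (compact_setX (compact_setX cI cI) cI)).
    apply: closedI; last first.
      apply: closed_bigI => u _; apply: closed_le_fun; last exact: cst.
      by apply: qform_continuous => //; exact: cst.
    by apply: closedI; [apply: closedI|]; apply: closed_le_fun => //; exact: cst.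
  move=> [[A B] C] /KP[/= A0 C0]; rewrite /det /= => D0 qF.
  have := qF 1 0; have := qF 0 1; rewrite /qform => HC HA.
  have {HC}HC : C <= F 0 1 by lra.
  have {HA}HA : A <= F 1 0 by lra.
  have HAC : A * C <= F 1 0 * F 0 1 by apply: ler_pM.
  by rewrite /= !in_itv/= /M; do !split; apply/andP; split; nra.
have Km : K (m, 0, m).
  apply/KP; rewrite /det /=; split; rewrite ?ltW//.
    by rewrite expr0n subr0 mulr_gt0.
  by move=> a b; rewrite (le_trans _ (Fm a b))// /qform; lra.
have [||[[A B] C]] := @compact_EVT_max _ R det K _ cK.
- by exists (m, 0, m).
- exact: continuous_subspaceT.
rewrite inE => /KP[/= A0 C0 D0 qF] Dmax.
have Dm : 0 < A * C - B ^+ 2.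
  have := Dmax (m, 0, m); rewrite inE => /(_ Km); rewrite /det /=.
  by apply: lt_le_trans; nra.
exists A, B, C; split=> //.
  by rewrite lt_neqAle A0 andbT; apply/eqP => A0'; move: Dm; rewrite -A0'; nra.
move=> A' B' C' A'0 C'0 D'0 qF'.
by have := Dmax (A', B', C'); rewrite inE; apply; apply/KP.
Qed.

(** If all contact points lay on one line, shrinking the form slightly along that line and enlarging
    it more in the conjugate direction would keep it below [F] and increase its determinant. *)
Lemma max_det_contacts (R : realType) (F : R -> R -> R) (A B C : R) :
    continuous (fun z : R * R => F z.1 z.2) ->
    (forall t a b, F (t * a) (t * b) = t ^+ 2 * F a b) ->
    0 < A -> 0 < A * C - B ^+ 2 ->
    (forall a b, qform A B C a b <= F a b) ->
    (forall A' B' C', 0 <= A' -> 0 <= C' -> 0 <= A' * C' - B' ^+ 2 ->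
      (forall a b, qform A' B' C' a b <= F a b) ->
      A' * C' - B' ^+ 2 <= A * C - B ^+ 2) ->
  exists a b c d, [/\ F a b = qform A B C a b, F c d = qform A B C c d &
    a * d - b * c != 0].
Proof.
move=> cF hF A0 D0 qF Dmax; apply: contrapT => nC.
have {nC}nC a b c d : F a b = qform A B C a b -> F c d = qform A B C c d ->
    a * d - b * c = 0.
  move=> Fab Fcd; apply: contrapT => /eqP abcd; apply: nC.
  by exists a, b, c, d.
(* The line carrying all contacts is spanned by a nonzero contact if there is one; otherwise the
   origin is the only possible contact and [(1, 0)] serves. *)
have [e1 [e2 [e0 He]]] : exists e1 e2, 0 < e1 ^+ 2 + e2 ^+ 2 /\
    forall c d, F c d = qform A B C c d -> e1 * d - e2 * c = 0.
  have [[a [b [ab0 Fab]]]|nab] := pselect (exists a b, 0 < a ^+ 2 + b ^+ 2 /\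
      F a b = qform A B C a b).
    by exists a, b; split=> // c d; exact: nC.
  exists 1, 0; split; first by rewrite expr1n expr0n addr0.
  move=> c d Fcd; apply: contrapT => /eqP d0; apply: nab; exists c, d.
  split=> //; move: d0; rewrite mul1r mul0r subr0 => d0.
  by rewrite ltr_wpDl ?sqr_ge0// lt_neqAle eq_sym expf_neq0 ?sqr_ge0.
have qe0 := qform_gt0 A0 D0 e0.
set qe := qform A B C e1 e2 in qe0; set D := A * C - B ^+ 2 in D0 Dmax.
(* With [b] the polar form of [q], Gram's identity reads [q(e) q(x) - b(e,x)^2 = D (e1 x2 - e2
   x1)^2], whence the factor [k = D / q(e)]. *)
have [k k0 kqe] : exists2 k, 0 < k & k * qe = D.
  by exists (D / qe); rewrite ?divr_gt0// divfK ?gt_eqF.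
(* [y] is the q-square of the component q-orthogonal to (e1, e2), and
   the form [(1 - e) q + 3 e y] used below has determinant (1 - e)(1 + 2 e) D. *)
pose y (a b : R) : R := k * (e1 * b - e2 * a) ^+ 2.
(* Off the origin [h] is positive: where [F] touches [q], the point is on the line of [e], so [y]
   vanishes and the second entry is [q]. The factor 3 exceeds 2, so the determinant grows to first
   order in the perturbation. *)
pose h (a b : R) : R := Num.max (F a b - qform A B C a b) (qform A B C a b - 3 * y a b).
have yE a b : 3 * y a b = qform (3 * k * e2 ^+ 2) (- (3 * k * (e1 * e2)))
    (3 * k * e1 ^+ 2) a b.
  by rewrite /y /qform; ring.
have cst (c : R) : continuous (fun _ : R * R => c) by move=> ?; exact: cvg_cst.
have c1 : continuous (@fst R R) by move=> ?; exact: cvg_fst.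
have c2 : continuous (@snd R R) by move=> ?; exact: cvg_snd.
have [m m0 hm] : exists2 m, 0 < m & forall a b, m * (a ^+ 2 + b ^+ 2) <= h a b.
  apply: pos_hom2_lower => [z|t a b|a b ab0].
  - have cq : continuous (fun z : R * R => qform A B C z.1 z.2).
      exact: qform_continuous.
    apply: (@continuous_max R _ (fun z : R * R => F z.1 z.2 - qform A B C z.1 z.2)
      (fun z : R * R => qform A B C z.1 z.2 - 3 * y z.1 z.2)).
      exact: continuous_subr.
    apply: continuous_subr => //; rewrite (_ : (fun z => _) = fun z : R * R =>
      qform (3 * k * e2 ^+ 2) (- (3 * k * (e1 * e2))) (3 * k * e1 ^+ 2) z.1 z.2).
      exact: qform_continuous.
    by apply/funext => u; rewrite yE.
  - rewrite /h hF maxr_pMr ?sqr_ge0// /y /qform.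
    by congr Num.max; ring.
  - rewrite /h lt_max; have [//|] := ltP 0 (F a b - qform A B C a b).
    rewrite subr_le0 => Fq; have Fab : F a b = qform A B C a b.
      by apply/eqP; rewrite eq_le Fq qF.
    by rewrite /y He// expr0n mulr0 mulr0 subr0 qform_gt0.
pose E := 3 * k * (e1 ^+ 2 + e2 ^+ 2).
have E0 : 0 < E by rewrite /E mulr_gt0// mulr_gt0.
(* The bound [1 / 4] gives [(1 - e)(1 + 2 e) > 1]; the bound [m / E] makes [3 e y] at most [m] times
   the squared Euclidean norm. *)
pose e := Num.min (1 / 4) (m / E).
have ee0 : 0 < e by rewrite lt_min !divr_gt0//.
have e4 : e <= 1 / 4 by rewrite ge_min lexx.
have eE : e * E <= m by rewrite -ler_pdivlMr// ge_min lexx orbT.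
have C0 : 0 < C.
  by rewrite -(pmulr_rgt0 _ A0) (lt_le_trans D0)// gerBl sqr_ge0.
have : D * ((1 - e) * (1 + 2 * e)) <= D.
  have -> : D * ((1 - e) * (1 + 2 * e)) =
      ((1 - e) * A + e * (3 * k * e2 ^+ 2)) * ((1 - e) * C + e * (3 * k * e1 ^+ 2))
      - ((1 - e) * B - e * (3 * k * (e1 * e2))) ^+ 2.
    transitivity ((1 - e) ^+ 2 * D + (1 - e) * e * 3 * (k * qe)).
      by rewrite kqe; ring.
    by rewrite /D /qe /qform; ring.
  have e1' : 0 <= 1 - e by lra.
  have k2 t : 0 <= 3 * k * t ^+ 2.
    by rewrite mulr_ge0 ?sqr_ge0// mulr_ge0// ltW.
  apply: Dmax => [|||a b].
  - by rewrite addr_ge0 // mulr_ge0 // ltW.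
  - by rewrite addr_ge0 // mulr_ge0 // ltW.
  - have -> : ((1 - e) * A + e * (3 * k * e2 ^+ 2)) *
      ((1 - e) * C + e * (3 * k * e1 ^+ 2))
      - ((1 - e) * B - e * (3 * k * (e1 * e2))) ^+ 2 =
      (1 - e) ^+ 2 * D + (1 - e) * e * 3 * (k * qe).
      by rewrite /D /qe /qform; ring.
    rewrite kqe addr_ge0 ?(mulr_ge0 (sqr_ge0 _)) ?(ltW D0)//.
    by rewrite !(mulr_ge0 _ (ltW D0)) // !mulr_ge0 // ltW.
  - have -> : qform ((1 - e) * A + e * (3 * k * e2 ^+ 2))
      ((1 - e) * B - e * (3 * k * (e1 * e2)))
      ((1 - e) * C + e * (3 * k * e1 ^+ 2)) a b =
      qform A B C a b - e * (qform A B C a b - 3 * y a b).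
      by rewrite /y /qform; ring.
    have ab0 : 0 <= a ^+ 2 + b ^+ 2 by rewrite addr_ge0 ?sqr_ge0.
    (* Where [q - 3 y] is the large entry, the new form is below [q]. Where [F - q] is, that slack
       absorbs the increase [3 e y]. *)
    have := hm a b; rewrite /h le_max => /orP[H|H]; last first.
      have {}H : 0 <= qform A B C a b - 3 * y a b.
        by apply: le_trans H; rewrite mulr_ge0// ltW.
      by rewrite (le_trans _ (qF a b))// gerBl mulr_ge0// ltW.
    have q0 : 0 <= qform A B C a b.
      have [abE|abN] := eqVneq (a ^+ 2 + b ^+ 2) 0.
        have -> : a = 0 by nra.
        have -> : b = 0 by nra.
        by rewrite /qform !(mulr0, expr0n) !addr0.
      by rewrite ltW// qform_gt0// lt_neqAle eq_sym abN.
    have ye : e * (3 * y a b) <= m * (a ^+ 2 + b ^+ 2).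
      apply: le_trans (ler_wpM2r ab0 eE).
      rewrite -mulrA ler_pM2l// /y /E -!mulrA !ler_pM2l ?ltr0n//.
      (* Cauchy-Schwarz, by Lagrange's identity. *)
      have := sqr_ge0 (e1 * a + e2 * b); lra.
    nra.
rewrite ger_pMr// leNgt => /negP; apply; nra.
Qed.

(** * Rigidity: the inequality forces a quadratic form on every plane *)

(** Contacts fill the segment between two independent contacts, then the cone they span; sign
    changes of the two generators give four cones covering the plane. *)
Lemma qform_of_ineq (R : realType) (F : R -> R -> R) :
    continuous (fun z : R * R => F z.1 z.2) ->
    (forall t a b, F (t * a) (t * b) = t ^+ 2 * F a b) ->
    (forall a b, 0 < a ^+ 2 + b ^+ 2 -> 0 < F a b) ->
    (forall a b c d, F a b = F c d ->
      F (3 * a + c) (3 * b + d) + F (3 * a - c) (3 * b - d) <= 20 * F a b) ->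
  exists A B C, forall a b, F a b = qform A B C a b.
Proof.
move=> cF hF pF ineq.
have [A [B [C [A0 D0 qF Dmax]]]] := max_det_qform cF hF pF.
exists A, B, C.
have [p1 [p2 [r1 [r2 [Fp Fr pr0]]]]] := max_det_contacts cF hF A0 D0 qF Dmax.
pose q := qform A B C; pose P a b := F a b = q a b.
have hq t a b : q (t * a) (t * b) = t ^+ 2 * q a b by rewrite /q /qform; ring.
have hP t a b : P a b -> P (t * a) (t * b) by rewrite /P hF hq => ->.
(* [F] dominates [q] at both [3u + v] and [3u - v], while the sum of its two values is at most that
   of [q], so both are equalities. *)
have step a b c d : P a b -> P c d -> q a b = q c d ->
    P (3 * a + c) (3 * b + d).
  rewrite /P => Pab Pcd qE.
  have Hi : F a b = F c d by rewrite Pab Pcd.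
  have := ineq _ _ _ _ Hi; rewrite Pab => {}Hi.
  have H1 := qF (3 * a + c) (3 * b + d); have H2 := qF (3 * a - c) (3 * b - d).
  apply/eqP; rewrite eq_le qF andbT.
  have : q (3 * a + c) (3 * b + d) + q (3 * a - c) (3 * b - d) =
    18 * q a b + 2 * q c d by rewrite /q /qform; ring.
  move: H1 H2 Hi; rewrite -/q; lra.
have seg u1 u2 v1 v2 t : P u1 u2 -> P v1 v2 -> u1 * v2 - u2 * v1 != 0 ->
    0 <= t <= 1 -> P ((1 - t) * u1 + t * v1) ((1 - t) * u2 + t * v2).
  move=> Pu Pv uv0 t01.
  pose w (s : R) : R * R := ((1 - s) * u1 + s * v1, (1 - s) * u2 + s * v2).
  have cst (c : R) : continuous (fun _ : R => c) by move=> ?; exact: cvg_cst.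
  have cid : continuous (fun x : R => x) by move=> ?; exact: cvg_id.
  have cw (a b : R) : continuous (fun s : R => (1 - s) * a + s * b).
    apply: continuous_addr; apply: continuous_mulr => //.
    exact: continuous_subr.
  (* Independent endpoints keep the segment away from the origin, so the square roots used for
     rescaling are positive. *)
  have q0 s : 0 < q (w s).1 (w s).2.
    apply: qform_gt0 => //; rewrite lt_neqAle eq_sym addr_ge0 ?sqr_ge0// andbT.
    apply/eqP => w0.
    have w1 : (w s).1 = 0 by nra.
    have w2 : (w s).2 = 0 by nra.
    move: w1 w2; rewrite /w /= => w1 w2.
    have s0 : s * (u1 * v2 - u2 * v1) = 0.
      transitivity (u1 * ((1 - s) * u2 + s * v2) - u2 * ((1 - s) * u1 + s * v1)).
        by ring.
      by rewrite w1 w2 !mulr0 subr0.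
    have s1 : (1 - s) * (u1 * v2 - u2 * v1) = 0.
      transitivity (v2 * ((1 - s) * u1 + s * v1) - v1 * ((1 - s) * u2 + s * v2)).
        by ring.
      by rewrite w1 w2 !mulr0 subr0.
    move/eqP: s0; rewrite mulf_eq0 (negbTE uv0) orbF => /eqP s0.
    by move/eqP: s1; rewrite s0 subr0 mul1r (negbTE uv0).
  apply: (@closed_between R [set s | P (w s).1 (w s).2] 0 1) => //=.
  - apply: (@closed_eq_fun R).
      move=> s; apply: (@continuous_comp _ _ _ w (fun z => F z.1 z.2)).
        exact: (cvg_pair (cw u1 v1 s) (cw u2 v2 s)).
      exact: cF.
    exact: qform_continuous.
  - by rewrite subr0 !mul1r !mul0r !addr0.
  - by rewrite subrr !mul1r !mul0r !add0r.
  move=> r s rs Pr Ps.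
  (* Scaling [w r] by the root of [q (w s)], and [w s] by the root of [q (w r)], equalizes their
     [q]-values. Then [step] yields the contact [x * w r + y * w s], which is [(x + y) * w m] with
     [m] a weighted mean of [r] and [s]. *)
  pose x := 3 * Num.sqrt (q (w s).1 (w s).2).
  pose y := Num.sqrt (q (w r).1 (w r).2).
  have x0 : 0 < x by rewrite mulr_gt0 ?ltr0n ?sqrtr_gt0.
  have y0 : 0 < y by rewrite sqrtr_gt0.
  have xy0 : 0 < x + y by rewrite addr_gt0.
  pose m := (x * r + y * s) / (x + y).
  have mE : (x + y) * m = x * r + y * s by rewrite /m mulrC divfK ?gt_eqF.
  exists m; first by apply/andP; split; nra.
  have := step _ _ _ _ (hP (Num.sqrt (q (w s).1 (w s).2)) _ _ Pr) (hP y _ _ Ps).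
  rewrite !hq !sqr_sqrtr ?ltW// mulrC => /(_ erefl); rewrite !mulrA -/x.
  have cmb (a c : R) : x * ((1 - r) * a + r * c) + y * ((1 - s) * a + s * c) =
     (x + y) * ((1 - m) * a + m * c).
    transitivity (((x + y) - (x + y) * m) * a + (x + y) * m * c); last by ring.
    by rewrite mE; ring.
  rewrite /w /= !cmb => /(hP (x + y)^-1).
  by rewrite !mulrA mulVf ?gt_eqF// !mul1r.
have cone u1 u2 v1 v2 a b : P u1 u2 -> P v1 v2 -> u1 * v2 - u2 * v1 != 0 ->
    0 <= a -> 0 <= b -> P (a * u1 + b * v1) (a * u2 + b * v2).
  move=> Pu Pv uv0 a0 b0; have [ab0|ab0] := eqVneq (a + b) 0.
    have -> : a = 0 by lra.
    have -> : b = 0 by lra.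
    by have := hP 0 _ _ Pu; rewrite !mul0r !addr0.
  have ab0' : 0 < a + b by rewrite lt_neqAle eq_sym ab0 addr_ge0.
  have := seg _ _ _ _ (b / (a + b)) Pu Pv uv0.
  rewrite divr_ge0 ?(ltW ab0')//= ler_pdivrMr// mul1r lerDr => /(_ a0).
  move/(hP (a + b)).
  have E (x y : R) : (a + b) * ((1 - b / (a + b)) * x + b / (a + b) * y) =
    a * x + b * y by field.
  by rewrite !E.
move=> a b; rewrite -/q -/(P a b).
set d := p1 * r2 - p2 * r1 in pr0.
(* Cramer's rule: coordinates of [(a, b)] in the basis of the two contacts. *)
pose s := (a * r2 - b * r1) / d; pose t := (p1 * b - p2 * a) / d.
have aE : a = s * p1 + t * r1 by rewrite /s /t /d; field.
have bE : b = s * p2 + t * r2 by rewrite /s /t /d; field.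
have hN x y : P x y -> P (- x) (- y) by move/(hP (-1)); rewrite !mulN1r.
have Nw u1 u2 v1 v2 : u1 * v2 - u2 * v1 != 0 :> R ->
  (- u1) * v2 - (- u2) * v1 != 0 /\ u1 * (- v2) - u2 * (- v1) != 0.
  have E1 : - u1 * v2 - - u2 * v1 = - (u1 * v2 - u2 * v1) by ring.
  have E2 : u1 * - v2 - u2 * - v1 = - (u1 * v2 - u2 * v1) by ring.
  by rewrite E1 E2 oppr_eq0.
rewrite aE bE; have [s0|s0] := leP 0 s; have [t0|t0] := leP 0 t.
- exact: cone.
- have := cone _ _ _ _ s (- t) Fp (hN _ _ Fr) (Nw _ _ _ _ pr0).2 s0.
  by rewrite !mulrNN; apply; rewrite oppr_ge0 ltW.
- have := cone _ _ _ _ (- s) t (hN _ _ Fp) Fr (Nw _ _ _ _ pr0).1.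
  by rewrite !mulrNN; apply; rewrite // oppr_ge0 ltW.
- have := cone _ _ _ _ (- s) (- t) Fp Fr pr0.
  rewrite !mulNr -!opprD !oppr_ge0 => /(_ (ltW s0) (ltW t0))/hN.
  by rewrite !opprK.
Qed.

Lemma norm_qform (R : realType) (X : normedModType R) :
    (forall u v : X, `|u| = `|v| ->
      `|3 *: u + v| ^+ 2 + `|3 *: u - v| ^+ 2 <= 20 * `|u| ^+ 2) ->
  forall p r : X, exists A B C, forall a b : R,
    `|a *: p + b *: r| ^+ 2 = qform A B C a b.
Proof.
move=> ineq p r.
(* For dependent [p] and [r] the squared norm vanishes at a nonzero coefficient pair, so positivity
   fails; the degenerate form is written down directly. *)
have [[a [b [ab0 pr0]]]|indep] := pselect (exists a b : R,
    0 < a ^+ 2 + b ^+ 2 /\ a *: p + b *: r = 0).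
  have [b0|b0] := eqVneq b 0.
    move: ab0 pr0; rewrite b0 scale0r expr0n !addr0 => a0 /eqP.
    rewrite scaler_eq0 => /orP[/eqP a00|/eqP ->].
      by move: a0; rewrite a00 expr0n ltxx.
    exists 0, 0, (`|r| ^+ 2) => x y.
    by rewrite scaler0 add0r normrZ exprMn real_normK ?num_real// /qform; ring.
  have -> : r = (- (a / b)) *: p.
    apply: (scalerI b0); rewrite scalerA mulrN mulrC divfK// scaleNr.
    by apply/eqP; rewrite -addr_eq0 addrC pr0.
  set t := - (a / b).
  exists (`|p| ^+ 2), (t * `|p| ^+ 2), (t ^+ 2 * `|p| ^+ 2) => x y.
  rewrite scalerA -scalerDl normrZ exprMn real_normK ?num_real// /qform; ring.
apply: qform_of_ineq => [z|t a b|a b ab0|a b c d /pexpIrn abcd].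
- apply: continuous_sqr => {}z; apply: (@continuous_comp _ _ _
    (fun z : R * R => z.1 *: p + z.2 *: r) (fun x : X => `|x|)).
    apply: continuousD; apply: (@continuous_comp _ _ _ _ (fun k : R => k *: _)).
    + exact: cvg_fst.
    + exact: scalel_continuous.
    + exact: cvg_snd.
    + exact: scalel_continuous.
  exact: norm_continuous.
- by rewrite -!scalerA -scalerDr normrZ exprMn real_normK ?num_real.
- rewrite exprn_gt0// normr_gt0; apply/eqP => pr0; apply: indep.
  by exists a, b.
- have {}abcd : `|a *: p + b *: r| = `|c *: p + d *: r|.
    by apply: abcd; rewrite ?nnegrE.
  have E1 : (3 * a + c) *: p + (3 * b + d) *: r =
      3 *: (a *: p + b *: r) + (c *: p + d *: r).
    by rewrite scalerDr !scalerA addrACA -!scalerDl.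
  have E2 : (3 * a - c) *: p + (3 * b - d) *: r =
      3 *: (a *: p + b *: r) - (c *: p + d *: r).
    by rewrite opprD -!scaleNr scalerDr !scalerA addrACA -!scalerDl.
  by rewrite E1 E2; exact: ineq.
Qed.

(** * Inner product by polarization *)

Lemma scaler_halfD (R : realFieldType) (V : lmodType R) (u : V) :
  2^-1 *: u + 2^-1 *: u = u.
Proof. by rewrite -scalerDl -[RHS]scale1r; congr (_ *: _); field. Qed.

Lemma half_sumD (R : realFieldType) (V : lmodType R) (u v : V) :
  2^-1 *: (u + v) + 2^-1 *: (u - v) = u.
Proof. by rewrite -scalerDr addrACA subrr addr0 scalerDr scaler_halfD. Qed.

Lemma half_sumB (R : realFieldType) (V : lmodType R) (u v : V) :
  2^-1 *: (u + v) - 2^-1 *: (u - v) = v.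
Proof. by rewrite -scalerBr opprB (addrC u) addrACA subrr addr0 scalerDr scaler_halfD. Qed.

(** Symmetry is immediate, and real homogeneity is an identity in the coefficients of one planar
    form. Additivity involves three vectors, so it is derived from the parallelogram law as in
    Jordan and von Neumann. *)
Lemma norm_from_inner_product_of_qform (R : realType) (X : normedModType R) :
    (forall p r : X, exists A B C, forall a b : R,
      `|a *: p + b *: r| ^+ 2 = qform A B C a b) ->
  norm_from_inner_product X.
Proof.
move=> Q.
pose ip (x y : X) : R := (`|x + y| ^+ 2 - `|x - y| ^+ 2) / 4.
have paral (x y : X) : `|x + y| ^+ 2 + `|x - y| ^+ 2 = 2 * `|x| ^+ 2 + 2 * `|y| ^+ 2.
  have [A [B [C H]]] := Q x y.
  have := H 1 1; have := H 1 (-1); have := H 1 0; have := H 0 1.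
  rewrite !scale1r !scale0r scaleN1r add0r addr0 => -> -> -> ->.
  by rewrite /qform; ring.
have ipC x y : ip x y = ip y x by rewrite /ip (addrC x) distrC.
have ipZ t x y : ip (t *: x) y = t * ip x y.
  have [A [B [C H]]] := Q x y; rewrite /ip.
  have := H 1 1; have := H 1 (-1); have := H t 1; have := H t (-1).
  by rewrite !scale1r !scaleN1r => -> -> -> ->; rewrite /qform; field.
have ipD x y z : ip (x + y) z = ip x z + ip y z.
  (* The parallelogram law for [s + z, d] and for [s - z, d] gives
     [ip (s + d) z + ip (s - d) z = 2 * ip s z]. *)
  pose s := 2^-1 *: (x + y); pose d := 2^-1 *: (x - y).
  have xE : x = s + d by rewrite half_sumD.
  have yE : y = s - d by rewrite half_sumB.
  have -> : x + y = 2 *: s by rewrite scalerA divff ?pnatr_eq0// scale1r.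
  rewrite ipZ {1}xE {1}yE /ip.
  have := paral (s + z) d; have := paral (s - z) d.
  rewrite [s + z + d]addrAC [s - z + d]addrAC [s + z - d]addrAC [s - z - d]addrAC.
  lra.
(* The bilinear structure built below takes additivity in the form of differences. *)
have ipB x y z : ip (x - y) z = ip x z - ip y z.
  by rewrite ipD -scaleN1r ipZ mulN1r.
have ipxx x : `|x| ^+ 2 = ip x x.
  by rewrite /ip subrr normr0 -mulr2n -scaler_nat normrZ (ger0_norm (ler0n _ 2)) expr0n /=; field.
pose bil := isBilinear.Build R X X R ( *%R) (idfun \; *%R) ip
  (fun z x y => ipB x y z)
  (fun z x y => etrans (ipC _ _) (etrans (ipB _ _ _)
    (congr2 (fun a b => a - b) (ipC _ _) (ipC _ _))))
  (fun z t x => ipZ t x z)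
  (fun z t x => etrans (ipC _ _) (etrans (ipZ _ _ _)
    (congr1 (fun a => t * a) (ipC _ _)))).
have ipH : forall x y, ip x y = (-1) ^+ false * idfun (ip y x).
  by move=> x y; rewrite mul1r ipC.
have ip0 x : x != 0 -> 0 < ip x x by rewrite -ipxx => x0; rewrite exprn_gt0 ?normr_gt0.
pose her := isHermitianSesquilinear.Build R X false idfun ip ipH.
pose dot := isDotProduct.Build R X ip ip0.
pose f : {dot X for idfun} := HB.pack ip bil her dot.
by exists f.
Qed.

(** * The constant and the equivalence *)

Lemma Omega'_le1_ineq (R : realType) (X : normedModType R) :
    ubound (Omega'_set X) 1 ->
  forall u v : X, `|u| = `|v| ->
    `|3 *: u + v| ^+ 2 + `|3 *: u - v| ^+ 2 <= 20 * `|u| ^+ 2.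
Proof.
(* Here [u = 0] forces [v = 0], the pair excluded from the supremum. *)
move=> ub u v uv; have [u0|u0] := eqVneq u 0.
  move: uv; rewrite u0 normr0 => /esym/normr0_eq0 ->.
  by rewrite scaler0 subr0 addr0 normr0 expr0n mulr0 addr0.
pose x := 2^-1 *: (u + v); pose y := 2^-1 *: (u - v).
have xyD : x + y = u by exact: half_sumD.
have xyB : x - y = v by exact: half_sumB.
have x2y : x + 2 *: y = 2^-1 *: (3 *: u - v).
  have -> : 2 *: y = y + y by rewrite scaler_nat mulr2n.
  rewrite addrA xyD -[X in X + _]scaler_halfD /y !scalerDr scalerA addrA -!scalerDl.
  by congr (_ *: _ + _); field.
have xx2y : 2 *: x + y = 2^-1 *: (3 *: u + v).
  have -> : 2 *: x = x + x by rewrite scaler_nat mulr2n.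
  rewrite addrAC xyD -[X in X + _]scaler_halfD /x !scalerDr scalerA addrA -!scalerDl.
  by congr (_ *: _ + _); field.
have n0 : 0 < `|u| by rewrite normr_gt0.
have := ub ((`|x + 2 *: y| ^+ 2 + `|2 *: x + y| ^+ 2) / (5 * `|x + y| ^+ 2)).
move=> /(_ _); rewrite ler_pdivrMr ?xyD ?mulr_gt0 ?exprn_gt0// x2y xx2y.
rewrite !normrZ !exprMn ger0_norm ?invr_ge0// => H.
have : 2^-1 ^+ 2 * `|3 *: u - v| ^+ 2 + 2^-1 ^+ 2 * `|3 *: u + v| ^+ 2 <=
    1 * (5 * `|u| ^+ 2).
  apply: H; exists x, y; rewrite /isosceles_orth xyD xyB; split=> //.
    by move=> [x0 y0]; move: u0; rewrite -xyD x0 y0 addr0 eqxx.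
  by rewrite x2y xx2y !normrZ !exprMn ger0_norm ?invr_ge0.
have -> : (2^-1 : R) ^+ 2 = 4^-1 by field.
lra.
Qed.

Lemma dim_ge_leq (K : fieldType) (V : lmodType K) (m n : nat) :
  (m <= n)%N -> dim_ge V n -> dim_ge V m.
Proof.
move=> mn [v vfree]; exists (fun i => v (widen_ord mn i)) => c c0 i.
(* The coefficients are extended by zero beyond [m]. *)
have := vfree (fun j => if insub (val j) is Some k then c k else 0).
move=> /(_ _ (widen_ord mn i)) /=; rewrite valK; apply.
rewrite (bigID (fun j : 'I_n => j < m)%N) /= [X in _ + X]big1 => [|j jm].
  rewrite addr0 -[RHS]c0 (big_ord_narrow mn).
  by apply: eq_bigr => j _; rewrite valK.
by rewrite insubF ?scale0r //; exact: negbTE.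
Qed.

Lemma Omega'_inner_product (R : realType) (X : normedModType R) :
  dim_ge X 1 -> norm_from_inner_product X -> Omega' X = 1.
Proof.
move=> hdim [ip ipE].
have ipC x y : ip x y = ip y x by rewrite hermitian_subproof mul1r.
have nD (x y : X) : `|x + y| ^+ 2 = `|x| ^+ 2 + 2 * ip x y + `|y| ^+ 2.
  by rewrite !ipE linearDl /= !linearD /= (ipC y x); ring.
(* Nonemptiness turns [every quotient is 1] into equality with the singleton of 1. *)
have [[r0 Or0] _] := has_sup_Omega'_set hdim.
suff OE r : Omega'_set X r -> r = 1.
  rewrite /Omega' (_ : Omega'_set X = [set 1]) ?sup1//.
  by apply/seteqP; split=> [r /OE//|_ ->]; rewrite -(OE _ Or0).
move=> [x [y [nz xy ->]]].
have n0 : 0 < `|x + y| by rewrite normr_gt0 isosceles_orth_add_neq0.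
have ip0 : ip x y = 0.
  have := nD x y; rewrite xy nD normrN linearN /=; lra.
(* With [ip x y = 0] the cross terms vanish and both sides are five times the sum of the squared
   norms of [x] and [y]. *)
have -> : `|x + 2 *: y| ^+ 2 + `|2 *: x + y| ^+ 2 = 5 * `|x + y| ^+ 2.
  rewrite !nD linearZ /= (ipC (2 *: x)) linearZ /= (ipC y) ip0 !normrZ ger0_norm//.
  ring.
by rewrite divff// mulf_neq0 ?expf_neq0 ?gt_eqF ?pnatr_eq0.
Qed.

Theorem proposition5p5 (R : realType) (X : normedModType R) (hdim : dim_ge X 2) :
  norm_from_inner_product X <-> Omega' X = 1%R.
Proof.
have hdim1 : dim_ge X 1 by apply: dim_ge_leq hdim.
split=> [|O1]; first exact: Omega'_inner_product.
apply: norm_from_inner_product_of_qform; apply: norm_qform.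
apply: Omega'_le1_ineq; rewrite -O1.
(* [has_sup] is what makes the value of [sup] an actual upper bound. *)
exact/sup_upper_bound/has_sup_Omega'_set.
Qed.
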